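(* Let $A,B\in\mathbb{R}^{n\times n}$. If $A-B$ is nonsingular and $Q:=(A^{\mathsf T}+B^{\mathsf T})(A^{\mathsf T}-B^{\mathsf T})^{-1}$ is a $P$-matrix, then for any $c\in\mathbb{R}^n$, $$\operatorname{Fix}(P_{C_1}\circ P_{C_2})=C_1\cap C_2 .$$ In particular, this equality holds (for any $c\in\mathbb{R}^n$) if $\sigma_{\min}(A)>\sigma_{\max}(B)$.
   Context: A square matrix is a $P$-matrix if all its principal minors are positive. $\sigma_{\min}$, $\sigma_{\max}$ denote the smallest and largest singular values. With $T=[\,A+B\;\;\;-A+B\,]\in\mathbb{R}^{n\times 2n}$, $C_1:=\{w\in\mathbb{R}^n\times\mathbb{R}^n: Tw=\sqrt2\,c\}$ and $C_2:=\{w=(u,v)\in\mathbb{R}^n\times\mathbb{R}^n: u\ge 0,\ v\ge 0,\ \langle u,v\rangle=0\}$ (inequalities componentwise). For a set $S$, $P_S(z):=\{s\in S:\|s-z\|\le\|t-z\|\ \forall t\in S\}$ is the (possibly multivalued) Euclidean metric projector. $(P_{C_1}\circ P_{C_2})(w)=\bigcup_{w'\in P_{C_2}(w)}P_{C_1}(w')$, and $\operatorname{Fix}(P_{C_1}\circ P_{C_2})=\{w: w\in(P_{C_1}\circ P_{C_2})(w)\}$. *)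

(* Defs.v *)
From mathcomp Require Import all_boot all_order all_algebra.
From mathcomp Require Import all_classical all_reals.

Set Implicit Arguments.
Unset Strict Implicit.
Unset Printing Implicit Defensive.

Import Order.TTheory GRing.Theory Num.Theory.

Local Open Scope classical_set_scope.
Local Open Scope ring_scope.

(* The principal minor with S = set0 is the determinant of a 0 x 0 matrix,
   which is 1, so including it imposes nothing. *)
Definition P_matrix (R : realType) (n : nat) (M : 'M[R]_n) : Prop :=
  forall S : {set 'I_n},
    0 < \det (mxsub (fun i : 'I_#|S| => enum_val i)
                    (fun j : 'I_#|S| => enum_val j) M).

Definition singular_values (R : realType) (n : nat) (M : 'M[R]_n) : set R :=
  [set s | 0 <= s /\ eigenvalue (M^T *m M) (s ^+ 2)].

(* For n > 0 the set of singular values is finite and nonempty, so inf and sup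
   are its minimum and maximum; for n = 0 it is empty and both are 0. *)
Definition sigma_min (R : realType) (n : nat) (M : 'M[R]_n) : R :=
  inf (singular_values M).

Definition sigma_max (R : realType) (n : nat) (M : 'M[R]_n) : R :=
  sup (singular_values M).

Definition inner (R : realType) (m : nat) (x y : 'cV[R]_m) : R :=
  \sum_i x i 0 * y i 0.

(* The library norm on matrices is the sup norm, hence this definition. *)
Definition enorm (R : realType) (m : nat) (x : 'cV[R]_m) : R :=
  Num.sqrt (inner x x).

Definition projector (R : realType) (m : nat) (S : set 'cV[R]_m)
    (z : 'cV[R]_m) : set 'cV[R]_m :=
  [set s | S s /\ forall t, S t -> enorm (s - z) <= enorm (t - z)].

Definition comp_multi (T : Type) (F G : T -> set T) (w : T) : set T :=
  \bigcup_(w' in G w) F w'.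

Definition Fix (T : Type) (F : T -> set T) : set T := [set w | F w w].

(* R^n x R^n is 'cV[R]_(n + n): the pair (u, v) is col_mx u v, with
   u = usubmx w and v = dsubmx w. *)
Definition Tmx (R : realType) (n : nat) (A B : 'M[R]_n) : 'M[R]_(n, n + n) :=
  row_mx (A + B) (- A + B).

Definition C1 (R : realType) (n : nat) (A B : 'M[R]_n) (c : 'cV[R]_n) :
    set 'cV[R]_(n + n) :=
  [set w | Tmx A B *m w = Num.sqrt 2 *: c].

Definition C2 (R : realType) (n : nat) : set 'cV[R]_(n + n) :=
  [set w | [/\ forall i, 0 <= usubmx w i 0,
               forall i, 0 <= dsubmx w i 0 &
               inner (usubmx w) (dsubmx w) = 0]].
Arguments C2 : clear implicits.

Definition Qmx (R : realType) (n : nat) (A B : 'M[R]_n) : 'M[R]_n :=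
  (A^T + B^T) *m invmx (A^T - B^T).

(* Main.v *)
Require Import Defs.
From mathcomp Require Import all_boot all_order all_algebra.
From mathcomp Require Import perm ring lra.
From mathcomp Require Import all_classical all_reals.

Local Open Scope classical_set_scope.
Local Open Scope ring_scope.

Import Order.TTheory GRing.Theory Num.Theory.

(** A fixed point w comes with a point s of [C2] such that s projects w onto
    [C2] and w projects s onto [C1]. The residual d = w - s then carries two
    pieces of information.

    Since [C1] is an affine space of direction ker T, d is orthogonal to ker T,
    so d = T^T y for some y ([projector_affine]); its two halves are
    d1 = (A + B)^T y and d2 = (- A + B)^T y.

    Since [C2] is a product of copies of the boundary of the quadrant, a
    componentwise variation of s shows that d1_i and d2_i never have strictly
    opposite signs: one of them vanishes or both are nonpositive
    ([C2_residual_ge0]).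

    So it suffices that d1_i d2_i >= 0 for all i forces y = 0
    ([Fix_projectors_eq]); then w = s lies in both sets. Conversely, a point of
    the intersection is its own projection on either set.

    If Q is a P-matrix, put z = (A - B)^T y. Then d1 = Q z and d2 = - z, so Q
    reverses the sign of every component of z, which a P-matrix does only for
    z = 0 ([P_matrix_sign_reversal]): otherwise Q + D, restricted to the support
    of z, would be singular for some nonnegative diagonal D, whereas its
    determinant is positive ([P_matrix_add_diag_det_gt0]).

    Under the singular value condition, summing over i gives 0 <= <d1, d2> = |B^T y|^2 - |A^T y|^2, while
    |B^T y| <= sigma_max B |y| and sigma_min A |y| <= |A^T y|. These bounds hold
    because the infimum of the Rayleigh quotient of a symmetric matrix is one of
    its eigenvalues ([rayleigh_min]), here for A A^T and - B B^T. *)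

(** * The Euclidean inner product *)

Section Inner.
Context {R : realType}.

Lemma innerE {m} (x y : 'cV[R]_m) : inner x y = (x^T *m y) 0 0.
Proof. by rewrite mxE; apply: eq_bigr => i _; rewrite mxE. Qed.

Lemma innerC {m} (x y : 'cV[R]_m) : inner x y = inner y x.
Proof. by apply: eq_bigr => i _; rewrite mulrC. Qed.

Lemma innerDr {m} (x y z : 'cV[R]_m) : inner x (y + z) = inner x y + inner x z.
Proof. by rewrite !innerE mulmxDr mxE. Qed.

Lemma innerZr {m} a (x y : 'cV[R]_m) : inner x (a *: y) = a * inner x y.
Proof. by rewrite !innerE -scalemxAr mxE. Qed.

Lemma innerDl {m} (x y z : 'cV[R]_m) : inner (x + y) z = inner x z + inner y z.
Proof. by rewrite innerC innerDr !(innerC z). Qed.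

Lemma innerZl {m} a (x y : 'cV[R]_m) : inner (a *: x) y = a * inner x y.
Proof. by rewrite innerC innerZr innerC. Qed.

Lemma innerNr {m} (x y : 'cV[R]_m) : inner x (- y) = - inner x y.
Proof. by rewrite -scaleN1r innerZr mulN1r. Qed.

Lemma inner0r {m} (x : 'cV[R]_m) : inner x 0 = 0.
Proof. by rewrite innerE mulmx0 mxE. Qed.

Lemma inner_mulmx {m p} (M : 'M[R]_(m, p)) x y :
  inner x (M *m y) = inner (M^T *m x) y.
Proof. by rewrite !innerE trmx_mul trmxK mulmxA. Qed.

Lemma inner_ge0 {m} (x : 'cV[R]_m) : 0 <= inner x x.
Proof. by apply: sumr_ge0 => i _; rewrite -expr2 sqr_ge0. Qed.

Lemma inner_eq0 {m} {x : 'cV[R]_m} : inner x x = 0 -> x = 0.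
Proof.
move=> /psumr_eq0P x0; apply/matrixP => i j; rewrite ord1 mxE.
apply/eqP; rewrite -sqrf_eq0 expr2; apply/eqP; apply: x0 => // k _.
by rewrite -expr2 sqr_ge0.
Qed.

Lemma inner_gt0 {m} {x : 'cV[R]_m} : x != 0 -> 0 < inner x x.
Proof.
move=> x0; rewrite lt_neqAle inner_ge0 andbT eq_sym.
by apply: contra_neq x0; apply: inner_eq0.
Qed.

Lemma inner_addZ {m} (x y : 'cV[R]_m) t :
  inner (x + t *: y) (x + t *: y) =
  inner x x + 2 * t * inner x y + t ^+ 2 * inner y y.
Proof. by rewrite !(innerDl, innerDr, innerZl, innerZr) (innerC y x); ring. Qed.

(** Cauchy-Schwarz: the component of [x] orthogonal to [y] has a nonnegative
    square norm. *)
Lemma inner_sqr_le {m} (x y : 'cV[R]_m) :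
  inner x y ^+ 2 <= inner x x * inner y y.
Proof.
have [->|y0] := eqVneq y 0.
  by rewrite -(scale0r (0 : 'cV[R]_m)) !innerZr !mul0r mulr0 expr0n.
have yy := inner_gt0 y0.
have := inner_ge0 (x + (- (inner x y / inner y y)) *: y).
rewrite inner_addZ.
have -> : inner x x + 2 * - (inner x y / inner y y) * inner x y
    + (- (inner x y / inner y y)) ^+ 2 * inner y y
  = (inner x x * inner y y - inner x y ^+ 2) / inner y y.
  by field; rewrite gt_eqF.
by rewrite pmulr_lge0 ?invr_gt0// subr_ge0.
Qed.

Lemma inner_mulmx_bound {m p} (M : 'M[R]_(m, p)) :
  exists2 K, 0 < K & forall x, inner (M *m x) (M *m x) <= K * inner x x.
Proof.
exists (1 + \sum_i inner (row i M)^T (row i M)^T) => [|x].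
  by rewrite ltr_pwDl// sumr_ge0// => i _; apply: inner_ge0.
rewrite mulrDl mul1r mulr_suml ler_wpDl ?inner_ge0// [leLHS]/inner.
apply: ler_sum => i _; rewrite -expr2.
have -> : (M *m x) i 0 = inner (row i M)^T x.
  by rewrite innerE trmxK -row_mul [RHS]mxE.
exact: inner_sqr_le.
Qed.

Lemma rayleigh_bound {m} (M : 'M[R]_m) :
  exists2 K, 0 < K & forall x, `|inner x (M *m x)| <= K * inner x x.
Proof.
have [K K0 bM] := inner_mulmx_bound M.
exists (1 + K) => [|x]; first by rewrite ltr_pwDl// ltW.
have := bM x; have := inner_ge0 (x + 1 *: (M *m x)).
have := inner_ge0 (x + (-1) *: (M *m x)); have := inner_ge0 x.
have := inner_ge0 (M *m x).
rewrite !inner_addZ ler_norml; set a := inner x x; set b := inner x _.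
set c := inner (M *m x) _ => *; apply/andP; split; lra.
Qed.

End Inner.

(** * The smallest eigenvalue of a symmetric matrix *)

Section Rayleigh.
Context {R : realType} {n : nat}.

(** A positive semidefinite form controls the vector [N *m x], not only its value
    at [x]: expand the form at x - t N x, with t the inverse of an upper bound
    of the Rayleigh quotient. This quantifies that isotropic vectors lie in the
    kernel. *)
Lemma psd_mulmx_bound {N : 'M[R]_n} : N^T = N ->
  (forall x, 0 <= inner x (N *m x)) ->
  exists2 K, 0 < K &
    forall x, inner (N *m x) (N *m x) <= K * inner x (N *m x).
Proof.
move=> Nsym Npsd; have [K K0 bN] := rayleigh_bound N; exists K => // x.
have Ki := invr_gt0 K; rewrite K0 in Ki.
set y := N *m x.
have := Npsd (x + (- K^-1) *: y).
rewrite mulmxDr -scalemxAr !(innerDl, innerDr, innerZl, innerZr) -/y.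
have -> : inner x (N *m y) = inner y y by rewrite inner_mulmx Nsym.
have := le_trans (ler_norm _) (bN y).
set a := inner x y; set b := inner y y; set c := inner y _ => cK h.
have /(_ cK) h2 : c <= K * b -> K^-1 * (K^-1 * c) <= K^-1 * b.
  by move=> ?; rewrite ler_pM2l// ler_pdivrMl.
have : 0 <= a - K^-1 * b by lra.
by rewrite subr_ge0 ler_pdivrMl.
Qed.

Lemma eigenvalue_unit (M : 'M[R]_n) a :
  eigenvalue M a = (M - a%:M \notin unitmx).
Proof. by rewrite /eigenvalue /eigenspace kermx_eq0 row_free_unit. Qed.

(** The infimum mu of the Rayleigh quotient is an eigenvalue. No minimizer is
    needed: S - mu is positive semidefinite, so if it were invertible
    [psd_mulmx_bound] would bound its form below by a positive multiple of
    |x|^2, and mu could be increased. *)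
Lemma rayleigh_min {S : 'M[R]_n} {x0 : 'cV[R]_n} : S^T = S -> x0 != 0 ->
  exists2 mu, eigenvalue S mu &
    forall x, mu * inner x x <= inner x (S *m x).
Proof.
move=> Ssym x0n0.
pose E := [set r | exists2 x, x != 0 & r = inner x (S *m x) / inner x x].
have [K K0 bS] := rayleigh_bound S.
have Elb : has_lbound E.
  exists (- K) => _ [x xn0 ->].
  rewrite ler_pdivlMr ?inner_gt0// mulNr.
  by have := bS x; rewrite ler_norml => /andP[].
have Ene : E !=set0 by exists (inner x0 (S *m x0) / inner x0 x0); exists x0.
pose mu := inf E.
have mu_le x : mu * inner x x <= inner x (S *m x).
  have [->|xn0] := eqVneq x 0; first by rewrite mulmx0 inner0r mulr0.
  by rewrite -ler_pdivlMr ?inner_gt0//; apply: ge_inf => //; exists x.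
exists mu => //; rewrite eigenvalue_unit; apply/negP => Nunit.
set N := S - mu%:M in Nunit.
have NE x : inner x (N *m x) = inner x (S *m x) - mu * inner x x.
  by rewrite mulmxBl mul_scalar_mx innerDr innerNr innerZr.
have Nsym : N^T = N by rewrite /N linearB /= Ssym tr_scalar_mx.
have [|K1 K10 b1] := psd_mulmx_bound Nsym.
  by move=> x; rewrite NE subr_ge0.
have [K2 K20 b2] := inner_mulmx_bound (invmx N).
have : mu + (K2 * K1)^-1 <= mu.
  apply: lb_le_inf => // _ [x xn0 ->].
  rewrite ler_pdivlMr ?inner_gt0// mulrDl -lerBrDl -NE ler_pdivrMl ?mulr_gt0//.
  have := b2 (N *m x); rewrite mulKmx// => /le_trans; apply.
  by rewrite -mulrA ler_pM2l.
by rewrite gerDl leNgt invr_gt0 mulr_gt0.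
Qed.

End Rayleigh.

(** * Bounds by the extreme singular values *)

Section SingularValues.
Context {R : realType} {n : nat}.

(** If [v] is an eigenvector of M M^T then v M is one of M^T M, unless it
    vanishes; in that case the eigenvalue is 0 and [M] is singular. *)
Lemma eigenvalue_mulmx_trC {M : 'M[R]_n} {a} :
  eigenvalue (M *m M^T) a -> eigenvalue (M^T *m M) a.
Proof.
move=> /eigenvalueP[v vE v0].
have [vM0|vM] := eqVneq (v *m M) 0; last first.
  apply/eigenvalueP; exists (v *m M) => //.
  by rewrite !mulmxA -(mulmxA v) vE scalemxAl.
have a0 : a = 0.
  apply/eqP; move/eqP: vE.
  by rewrite mulmxA vM0 mul0mx eq_sym scaler_eq0 (negPf v0) orbF.
have Mu : M \notin unitmx.
  by apply: contra_neqN v0 => Mu; rewrite -(mulmxK Mu v) vM0 mul0mx.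
by rewrite eigenvalue_unit a0 raddf0 subr0 unitmx_mul unitmx_tr (negPf Mu).
Qed.

Lemma eigenvalue_gram_ge0 {M : 'M[R]_n} {a} :
  eigenvalue (M^T *m M) a -> 0 <= a.
Proof.
move=> /eigenvalueP[v vE v0].
have vT0 : v^T != 0 by rewrite trmx_eq0.
rewrite -(pmulr_lge0 _ (inner_gt0 vT0)) -innerZr -linearZ /= -vE.
by rewrite !trmx_mul trmxK -mulmxA inner_mulmx trmxK inner_ge0.
Qed.

Lemma eigenvalueN {M : 'M[R]_n} {a} : eigenvalue (- M) a -> eigenvalue M (- a).
Proof.
move=> /eigenvalueP[v vE v0]; apply/eigenvalueP; exists v => //.
by rewrite scaleNr -vE mulmxN opprK.
Qed.

Lemma singular_value_sqrt {M : 'M[R]_n} {a} :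
  eigenvalue (M *m M^T) a -> singular_values M (Num.sqrt a) /\ 0 <= a.
Proof.
move=> /eigenvalue_mulmx_trC ev; have a0 := eigenvalue_gram_ge0 ev.
by split=> //; split; rewrite ?sqrtr_ge0 ?sqr_sqrtr.
Qed.

Lemma inner_trmx (M : 'M[R]_n) y :
  inner (M^T *m y) (M^T *m y) = inner y (M *m M^T *m y).
Proof. by rewrite -mulmxA [RHS]inner_mulmx. Qed.

Lemma mulmx_tr_sym (M : 'M[R]_n) : (M *m M^T)^T = M *m M^T.
Proof. by rewrite trmx_mul trmxK. Qed.

(** The smallest eigenvalue of M M^T is the square of a singular value, hence at
    least the square of the smallest one. *)
Lemma sigma_min_le (M : 'M[R]_n) (y : 'cV[R]_n) :
  sigma_min M ^+ 2 * inner y y <= inner (M^T *m y) (M^T *m y).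
Proof.
have [->|y0] := eqVneq y 0; first by rewrite mulmx0 !inner0r mulr0.
have [mu /singular_value_sqrt[sv mu0] mu_le] := rayleigh_min (mulmx_tr_sym M) y0.
rewrite inner_trmx; apply: le_trans (mu_le y).
rewrite ler_pM2r ?inner_gt0// -[leRHS]sqr_sqrtr//.
have lb0 : lbound (singular_values M) 0 by move=> s [].
rewrite ler_pXn2r// ?nnegrE ?sqrtr_ge0//; first exact: (ge_inf (ex_intro _ _ lb0)).
by apply: lb_le_inf => //; exists (Num.sqrt mu).
Qed.

(** Needed because the supremum of an unbounded set is 0 by convention. *)
Lemma singular_values_ubound (M : 'M[R]_n) : has_ubound (singular_values M).
Proof.
have [K K0 bM] := inner_mulmx_bound M; exists (Num.sqrt K) => s [s0].
move=> /eigenvalueP[v vE v0].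
have vT0 : v^T != 0 by rewrite trmx_eq0.
rewrite -(ler_pXn2r (ltn0Sn 1)) ?nnegrE ?sqrtr_ge0// (sqr_sqrtr (ltW K0)).
rewrite -(ler_pM2r (inner_gt0 vT0)) -innerZr -linearZ /= -vE.
by rewrite !trmx_mul trmxK -mulmxA inner_mulmx trmxK.
Qed.

(** The largest eigenvalue of M M^T is minus the smallest one of its opposite. *)
Lemma sigma_max_ge (M : 'M[R]_n) (y : 'cV[R]_n) :
  inner (M^T *m y) (M^T *m y) <= sigma_max M ^+ 2 * inner y y.
Proof.
have [->|y0] := eqVneq y 0; first by rewrite mulmx0 !inner0r mulr0.
have sym : (- (M *m M^T))^T = - (M *m M^T) by rewrite linearN /= mulmx_tr_sym.
have [mu /eigenvalueN/singular_value_sqrt[sv mu0] mu_le] := rayleigh_min sym y0.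
have := mu_le y; rewrite mulNmx innerNr inner_trmx lerNr -mulNr => /le_trans; apply.
have sle : Num.sqrt (- mu) <= sigma_max M.
  exact: ub_le_sup (singular_values_ubound M) _ sv.
rewrite ler_pM2r ?inner_gt0// -[leLHS]sqr_sqrtr//.
by rewrite ler_pXn2r// ?nnegrE ?sqrtr_ge0// (le_trans _ sle) ?sqrtr_ge0.
Qed.

Lemma sigma_max_ge0 (M : 'M[R]_n) : 0 <= sigma_max M.
Proof.
have [[s sv]|/set0P/negP/negPn/eqP e] := pselect (singular_values M !=set0).
  by rewrite (le_trans (proj1 sv)) // (ub_le_sup (singular_values_ubound M)).
by rewrite /sigma_max e sup0.
Qed.

End SingularValues.

(** * P-matrices *)

Section PMatrix.
Context {R : realType}.

Lemma det_perm_conj {n} (M : 'M[R]_n) (s : 'S_n) :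
  \det (mxsub s s M) = \det M.
Proof.
have -> : mxsub s s M = row_perm s (col_perm s M).
  by apply/matrixP => i j; rewrite !mxE.
rewrite row_permE col_permE !det_mulmx !det_perm mulrC -mulrA odd_permV.
by rewrite -signr_addb addbb mulr1.
Qed.

Lemma det_mxsub_enum {n k} (M : 'M[R]_n) (S : {set 'I_n}) (f : 'I_k -> 'I_n) :
  k = #|S| -> injective f -> (forall i, f i \in S) ->
  \det (mxsub f f M) =
  \det (mxsub (fun i : 'I_#|S| => enum_val i) (fun j : 'I_#|S| => enum_val j) M).
Proof.
move=> ek; subst k => f_inj fS.
pose g i := enum_rank_in (fS i) (f i).
have gK i : enum_val (g i) = f i by rewrite enum_rankK_in.
have g_inj : injective g by move=> i j /(congr1 enum_val); rewrite !gK => /f_inj.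
rewrite -[RHS](det_perm_conj _ (perm g_inj)); congr (\det _).
by apply/matrixP => i j; rewrite !mxE !permE !gK.
Qed.

(** Injective index maps compose, unlike enumerations of subsets; the minors they
    define are principal minors up to a simultaneous permutation of rows and
    columns, which leaves the determinant unchanged. *)
Lemma P_matrix_minor {n k} {M : 'M[R]_n} (f : 'I_k -> 'I_n) :
  P_matrix M -> injective f -> 0 < \det (mxsub f f M).
Proof.
move=> PM f_inj.
rewrite (det_mxsub_enum _ (f @: 'I_k)%SET) ?card_imset ?card_ord// => i.
exact: imset_f.
Qed.

Lemma P_matrix_mxsub {n k} {M : 'M[R]_n} (f : 'I_k -> 'I_n) :
  P_matrix M -> injective f -> P_matrix (mxsub f f M).
Proof.
move=> PM f_inj S; rewrite -mxsub_comp.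
by apply: P_matrix_minor => // i j /f_inj/enum_val_inj.
Qed.

Lemma P_matrix_det_gt0 {n} {M : 'M[R]_n} : P_matrix M -> 0 < \det M.
Proof.
move=> PM; have := P_matrix_minor id PM (@inj_id _); congr (_ < \det _).
by apply/matrixP => i j; rewrite !mxE.
Qed.

(** The determinant is affine in the [i]-th diagonal entry, with the
    complementary principal minor as slope. *)
Lemma det_add_diag {n} (M : 'M[R]_n) (d : 'rV[R]_n) (i : 'I_n) :
  \det (M + diag_mx d) =
  \det (M + diag_mx (\row_j (if j == i then 0 else d 0 j))) +
  d 0 i * \det (mxsub (lift i) (lift i) M + diag_mx (\row_j d 0 (lift i j))).
Proof.
set d' := \row_j _.
pose N := \matrix_(k, j) (if k == i then (j == i)%:R else (M + diag_mx d) k j).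
(* Row i of M + diag d is row i of M + diag d' plus d_i times a unit row, and
   N is M + diag d with its row i replaced by that unit row. *)
rewrite (@determinant_multilinear _ _ _ (M + diag_mx d') N i 1 (d 0 i)).
- rewrite mul1r (expand_det_row N i) (bigD1 i)//= big1 ?addr0; last first.
    by move=> j /negPf ji; rewrite !mxE eqxx ji mul0r.
  rewrite mxE !eqxx mul1r /cofactor -signr_odd oddD addbb mul1r.
  congr (_ + _ * \det _); apply/matrixP => k j.
  rewrite !mxE [lift i k == i]eq_sym (negPf (neq_lift _ _)).
  by rewrite (inj_eq (@lift_inj _ i)).
- apply/rowP => j; rewrite !mxE eqxx mul1r [i == j]eq_sym.
  have [->|ji] := eqVneq j i; last by rewrite mulr0n mulr0 !addr0.
  by rewrite mulr1n mulr1 mul0rn addr0.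
- apply/matrixP => k j; rewrite !mxE.
  by rewrite [lift i k == i]eq_sym (negPf (neq_lift _ _)).
- apply/matrixP => k j; rewrite !mxE.
  by rewrite [lift i k == i]eq_sym (negPf (neq_lift _ _)).
Qed.

(** Induction on the number of nonzero entries of [d]: removing one of them with
    [det_add_diag] leaves two determinants of the same kind, the second one for
    a principal submatrix, which is again a P-matrix. *)
Lemma P_matrix_add_diag_det_gt0 {n} (M : 'M[R]_n) (d : 'rV[R]_n) :
  P_matrix M -> (forall i, 0 <= d 0 i) -> 0 < \det (M + diag_mx d).
Proof.
have [m] := ubnP #|[set i | d 0 i != 0]%SET|.
elim: m n M d => // m IH n M d dm PM d0.
have [/existsP[i di]|/existsPn dN] := boolP [exists i, d 0 i != 0]; last first.
  suff -> : d = 0 by rewrite raddf0 addr0 P_matrix_det_gt0.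
  by apply/rowP => i; rewrite mxE; apply/eqP/negPn.
rewrite (det_add_diag _ _ i).
have im : i \in [set i | d 0 i != 0]%SET by rewrite inE.
rewrite (cardsD1 i) im add1n ltnS in dm.
apply: ltr_wpDr; first last.
  apply: IH => // [|j]; last by rewrite mxE; case: ifP.
  apply: leq_ltn_trans dm; apply/subset_leq_card/fintype.subsetP => j.
  rewrite !inE !mxE; case: (j == i) => /=; last exact.
  by rewrite eqxx.
apply/ltW/mulr_gt0; first by rewrite lt_neqAle eq_sym di d0.
apply: IH => [||j]; last by rewrite mxE.
  apply: leq_ltn_trans dm; rewrite -(card_imset _ (@lift_inj _ i)).
  apply/subset_leq_card/fintype.subsetP => _ /imsetP[j + ->].
  by rewrite !inE mxE => ->; rewrite andbT eq_sym neq_lift.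
exact: (P_matrix_mxsub _ PM lift_inj).
Qed.

(** The theorem of Fiedler and Ptak. If z <> 0, then on the support of [z] the
    vector M z equals - D z with D diagonal and nonnegative, so that the
    principal submatrix of [M] on this support, increased by D, kills the
    restriction of [z]. *)
Lemma P_matrix_sign_reversal {n} (M : 'M[R]_n) (z : 'cV[R]_n) :
  P_matrix M -> (forall i, z i 0 * (M *m z) i 0 <= 0) -> z = 0.
Proof.
move=> PM zM; apply/eqP/negPn/negP => z0.
pose S := [set i | z i 0 != 0]%SET.
have zS (k : 'I_#|S|) : z (enum_val k) 0 != 0.
  by have := enum_valP k; rewrite inE.
pose N := mxsub (fun i : 'I_#|S| => enum_val i) (fun j : 'I_#|S| => enum_val j) M.
pose y : 'cV_#|S| := \col_k z (enum_val k) 0.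
pose d : 'rV_#|S| := \row_k - ((M *m z) (enum_val k) 0 / z (enum_val k) 0).
have PN : P_matrix N by apply: P_matrix_mxsub => //; apply: enum_val_inj.
have d0 i : 0 <= d 0 i.
  rewrite mxE oppr_ge0; set a := (M *m z) _ _; set b := z _ _.
  have -> : a / b = b * a * b^-1 ^+ 2 by field; exact: zS.
  by rewrite mulr_le0_ge0 ?sqr_ge0// zM.
have := P_matrix_add_diag_det_gt0 _ _ PN d0.
have Ny : (N + diag_mx d) *m y = 0.
  apply/colP => k; rewrite mulmxDl mul_diag_mx !mxE mulNr divfK//.
  apply/eqP; rewrite subr_eq0; apply/eqP.
  transitivity (\sum_(j in S) M (enum_val k) j * z j 0).
    by rewrite [RHS]big_enum_val; apply: eq_bigr => j _; rewrite !mxE.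
  rewrite [RHS](bigID (mem S)) /= [X in _ + X]big1 ?addr0// => j.
  by rewrite inE negbK => /eqP ->; rewrite mulr0.
have [i zi] : exists i, z i 0 != 0.
  apply/existsP; apply: contra_neqT z0 => /existsPn h; apply/colP => i.
  by rewrite mxE; apply/eqP/negPn.
have iS : i \in S by rewrite inE.
move=> /lt0r_neq0; rewrite -unitfE -unitmxE => U.
have : y = 0 by rewrite -(mulKmx U y) Ny mulmx0.
move=> /colP/(_ (enum_rank_in iS i)); rewrite !mxE enum_rankK_in// => /eqP.
by rewrite (negPf zi).
Qed.

End PMatrix.

(** * Residuals of metric projections *)

Section Projection.
Context {R : realType}.

(** Expansion of |s - w|^2 <= |s + x - w|^2. *)
Lemma projector_variation {m} {S : set 'cV[R]_m} {w s : 'cV[R]_m} x :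
  projector S w s -> S (s + x) -> 2 * inner (w - s) x <= inner x x.
Proof.
move=> [_ smin] /smin; rewrite ler_sqrt ?inner_ge0//.
have -> : s + x - w = s - w + 1 *: x by rewrite scale1r addrAC.
rewrite inner_addZ -(opprB s w) [inner (- _) x]innerC innerNr (innerC x).
by move=> h; lra.
Qed.

Lemma projector_self {m} (S : set 'cV[R]_m) w : S w -> projector S w w.
Proof.
move=> Sw; split=> // t _.
by rewrite subrr [leLHS]/enorm inner0r sqrtr0 sqrtr_ge0.
Qed.

Lemma quad_eq0 (a b : R) :
  0 <= b -> (forall t, 2 * t * a <= t ^+ 2 * b) -> a = 0.
Proof.
(* The difference t^2 b - 2 t a is least at t = a / b; b + 1 covers b = 0. *)
move=> b0 /(_ (a / (b + 1))) h.
have b1 : 0 < b + 1 by lra.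
have e : (a / (b + 1)) ^+ 2 * b - 2 * (a / (b + 1)) * a
  = - (a / (b + 1)) ^+ 2 * (b + 2) by field; rewrite gt_eqF.
have s0 := sqr_ge0 (a / (b + 1)).
have /eqP : (a / (b + 1)) ^+ 2 = 0 by move: h e s0; nra.
by rewrite sqrf_eq0 mulf_eq0 invr_eq0 (gt_eqF b1) orbF => /eqP.
Qed.

(** Variations along ker M show that the residual is orthogonal to ker M, and the
    orthogonal complement of ker M is the row space of [M]. *)
Lemma projector_affine {m p} {M : 'M[R]_(p, m)} {b : 'cV[R]_p} {w s : 'cV[R]_m} :
  projector [set x | M *m x = b] w s -> exists y, w - s = M^T *m y.
Proof.
move=> sP; have Ms : M *m s = b by case: sP.
have orth k : M *m k = 0 -> inner (w - s) k = 0.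
  move=> Mk; apply: (quad_eq0 _ _ (inner_ge0 k)) => t.
  have /(projector_variation _ sP) : [set x | M *m x = b] (s + t *: k).
    by rewrite /= mulmxDr Ms -scalemxAr Mk scaler0 addr0.
  by rewrite innerZr innerZl innerZr; move=> h; lra.
have /submxP[D DE] : ((w - s)^T <= M)%MS.
  rewrite submxE; apply/eqP/matrixP => i j; rewrite !ord1 [RHS]mxE.
  rewrite -[RHS](orth (col j (cokermx M))) ?innerE.
    by rewrite [RHS]mxE [LHS]mxE; apply: eq_bigr => k _; rewrite [col _ _ _ _]mxE.
  by rewrite colE (mulmxA M) mulmx_coker mul0mx.
by exists D^T; rewrite -trmx_mul -DE trmxK.
Qed.

Lemma C2E n (w : 'cV[R]_(n + n)) :
  C2 R n w <-> forall i, [/\ 0 <= w (lshift n i) 0, 0 <= w (rshift n i) 0 &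
                           w (lshift n i) 0 * w (rshift n i) 0 = 0].
Proof.
split=> [[u0 v0 uv] i|h].
  have := u0 i; have := v0 i; rewrite !mxE => vi ui; split=> //.
  have/psumr_eq0P/(_ i isT) := uv; rewrite !mxE; apply => k _.
  by rewrite mulr_ge0.
split=> [i|i|]; rewrite ?mxE; try by case: (h i).
by apply: big1 => i _; rewrite !mxE; case: (h i).
Qed.

(** First-order optimality on a half-line: [a] is the nearest point to a + d
    among the nonnegative reals. The inequality in [t] is the one given by
    [projector_variation] for a displacement of length [t] along a unit
    vector. *)
Lemma half_line_residual (a d : R) : 0 <= a ->
  (forall t, - a <= t -> 2 * t * d <= t ^+ 2) -> d <= 0 /\ (0 < a -> d = 0).
Proof.
move=> a0 h.
have d0 : d <= 0.
  by rewrite leNgt; apply/negP => d0; have := h d; nra.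
split=> // a1; apply/eqP; rewrite eq_le d0 /= leNgt; apply/negP => d1.
have [ad|ad] := leP (- a) d; first by have := h d ad; nra.
by have := h (- a) (lexx _); nra.
Qed.

(** At a component where one of the two coordinates of [s] is 0, the other one
    may be moved along the half-line of nonnegative reals without leaving [C2].
    If it is positive, the residual in that direction is 0; if both coordinates
    are 0, both residuals are nonpositive. *)
Lemma C2_residual_ge0 {n} {w s : 'cV[R]_(n + n)} i :
  projector (C2 R n) w s ->
  0 <= (w - s) (lshift n i) 0 * (w - s) (rshift n i) 0.
Proof.
move=> sP; have /C2E s2 := proj1 sP; have [u0 v0 uv] := s2 i.
have vary j t : C2 R n (s + t *: delta_mx j 0) -> 2 * t * (w - s) j 0 <= t ^+ 2.
  move=> /(projector_variation _ sP).
  have dE x : inner x (delta_mx j 0) = x j 0.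
    rewrite /inner (bigD1 j)//= big1 => [|k /negPf kj].
      by rewrite mxE !eqxx mulr1 addr0.
    by rewrite mxE kj mulr0.
  by rewrite !innerZr innerZl !dE !mxE !eqxx /= => h; lra.
have varyl : s (rshift n i) 0 = 0 -> forall t, - s (lshift n i) 0 <= t ->
    2 * t * (w - s) (lshift n i) 0 <= t ^+ 2.
  move=> vi t ht; apply: vary; apply/C2E => k; have [uk vk uvk] := s2 k.
  rewrite !mxE /= eq_rlshift !andbT mulr0 addr0 (inj_eq (@lshift_inj _ _)).
  have [->|ki] := eqVneq k i; last by rewrite mulr0 addr0.
  by rewrite vi mulr1 mulr0; split=> //; lra.
have varyr : s (lshift n i) 0 = 0 -> forall t, - s (rshift n i) 0 <= t ->
    2 * t * (w - s) (rshift n i) 0 <= t ^+ 2.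
  move=> ui t ht; apply: vary; apply/C2E => k; have [uk vk uvk] := s2 k.
  rewrite !mxE /= eq_lrshift !andbT mulr0 addr0 (inj_eq (@rshift_inj _ _)).
  have [->|ki] := eqVneq k i; last by rewrite mulr0 addr0.
  by rewrite ui mulr1 mul0r; split=> //; lra.
move/eqP: (uv); rewrite mulf_eq0 => /orP[] /eqP z0.
- have [dr0 dr] := half_line_residual _ _ v0 (varyr z0).
  have [v1|v1] := ltP 0 (s (rshift n i) 0); first by rewrite dr// mulr0.
  have {}v1 : s (rshift n i) 0 = 0 by apply/le_anti; rewrite v1.
  by have [dl0 _] := half_line_residual _ _ u0 (varyl v1); apply: mulr_le0.
- have [dl0 dl] := half_line_residual _ _ u0 (varyl z0).
  have [u1|u1] := ltP 0 (s (lshift n i) 0); first by rewrite dl// mul0r.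
  have {}u1 : s (lshift n i) 0 = 0 by apply/le_anti; rewrite u1.
  by have [dr0 _] := half_line_residual _ _ v0 (varyr u1); apply: mulr_le0.
Qed.

(** The residual has the form T^T y and satisfies the sign condition of
    [C2_residual_ge0]; where this forces y = 0, the two projections of a fixed
    point do not move it. *)
Lemma Fix_projectors_eq {n} (A B : 'M[R]_n) (c : 'cV[R]_n) :
  (forall y : 'cV[R]_n,
     (forall i, 0 <= ((A + B)^T *m y) i 0 * ((- A + B)^T *m y) i 0) -> y = 0) ->
  Fix (comp_multi (projector (C1 A B c)) (projector (C2 R n)))
    = C1 A B c `&` C2 R n.
Proof.
move=> trivial_residual; apply/seteqP; split=> w; last first.
  by move=> [w1 w2]; exists w; apply: projector_self.
move=> [s s2 w1]; split; first exact: (proj1 w1).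
have [y yE] := projector_affine w1.
have res i := C2_residual_ge0 i s2.
have y0 : y = 0.
  apply: trivial_residual => i; have := res i.
  rewrite -(opprB s w) yE /Tmx tr_row_mx mul_col_mx.
  by rewrite mxE [X in _ * X]mxE col_mxEu col_mxEd mulrNN.
have -> : w = s by apply/esym/eqP; rewrite -subr_eq0 yE y0 mulmx0.
exact: (proj1 s2).
Qed.

End Projection.

Theorem theorem2p16 (R : realType) (n : nat) (A B : 'M[R]_n) :
  (A - B \in unitmx -> P_matrix (Qmx A B) ->
     forall c : 'cV[R]_n,
       Fix (comp_multi (projector (C1 A B c)) (projector (C2 R n)))
         = C1 A B c `&` C2 R n)
  /\
  (sigma_max B < sigma_min A ->
     forall c : 'cV[R]_n,
       Fix (comp_multi (projector (C1 A B c)) (projector (C2 R n)))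
         = C1 A B c `&` C2 R n).
Proof.
split=> [AB PQ c|sAB c]; apply: Fix_projectors_eq => y yres.
- have ABT : A^T - B^T \in unitmx by rewrite -linearB /= unitmx_tr.
  have z0 : (A^T - B^T) *m y = 0.
    apply: (P_matrix_sign_reversal _ _ PQ) => i; have := yres i.
    have -> : (- A + B)^T = - (A^T - B^T) by rewrite opprB linearD linearN addrC.
    rewrite /Qmx -mulmxA mulKmx// linearD /= mulNmx [X in _ * X]mxE.
    by rewrite mulrN oppr_ge0 mulrC.
  by rewrite -(mulKmx ABT y) z0 mulmx0.
- have : 0 <= inner ((A + B)^T *m y) ((- A + B)^T *m y) by apply: sumr_ge0.
  have -> : inner ((A + B)^T *m y) ((- A + B)^T *m y)
      = inner (B^T *m y) (B^T *m y) - inner (A^T *m y) (A^T *m y).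
    rewrite !linearD linearN /= !mulmxDl mulNmx.
    rewrite !(innerDl, innerDr, innerNr) (innerC (A^T *m y) (B^T *m y)); ring.
  move=> h; apply: inner_eq0; apply/eqP; rewrite eq_le inner_ge0 andbT.
  have sq : 0 < sigma_min A ^+ 2 - sigma_max B ^+ 2.
    have := sigma_max_ge0 B; rewrite subr_gt0 => ?.
    by rewrite ltr_pXn2r// nnegrE; lra.
  rewrite -(pmulr_rle0 _ sq) mulrBl.
  by have := sigma_min_le A y; have := sigma_max_ge B y; lra.
Qed.
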